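(* Let $X$ be a compact Hausdorff space and $\pi:\mathcal{E}\to X$ a continuous Banach bundle (i.e. an (F) Banach bundle). The following conditions are equivalent: (a) $\mathcal{E}$ is locally trivial of finite rank; (b) the $C(X)$-module $\Gamma(\mathcal{E})$ of global continuous sections is algebraically finitely generated and projective; (c) the $C(X)$-module $\Gamma(\mathcal{E})$ is algebraically finitely generated.
   Context: All Banach spaces are complex; $C(X)$ is the algebra of continuous functions $X\to\mathbb{C}$. An (H) Banach bundle over $X$ is a continuous open surjection $\pi:\mathcal{E}\to X$ whose fibers $\mathcal{E}_x:=\pi^{-1}(x)$ are Banach spaces, such that: scalar multiplication $\mathbb{C}\times\mathcal{E}\to\mathcal{E}$ and fiberwise addition $\mathcal{E}\times_X\mathcal{E}\to\mathcal{E}$ are continuous; the norm $\mathcal{E}\to\mathbb{R}$ is upper semicontinuous; and for every $x\in X$ the sets $\{s\in\mathcal{E} : \pi(s)\in U,\ \|s\|<\varepsilon\}$ ($U$ a neighborhood of $x$, $\varepsilon>0$) form a fundamental system of neighborhoods of $0_x\in\mathcal{E}_x$. The bundle is continuous, or (F), if moreover the norm $\mathcal{E}\to\mathbb{R}$ is continuous. $\Gamma(\mathcal{E})$ is the space of continuous sections $X\to\mathcal{E}$ of $\pi$, a Banach module over $C(X)$ under pointwise operations and the supremum norm. $\mathcal{E}$ is locally trivial if $X$ is covered by open sets $U$ such that $\mathcal{E}|_U$ is isomorphic to $U\times E$ for some Banach space $E$, via a fiberwise linear homeomorphism over $U$ (not required to be fiberwise isometric); ''of finite rank'' means the fibers are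 finite-dimensional. Finite generation and projectivity of modules are in the ordinary algebraic sense. *)

(* Defs.v *)
From HB Require Import structures.
From mathcomp Require Import all_boot all_order all_algebra.
From mathcomp Require Import all_classical all_reals all_analysis.
From mathcomp Require Import complex.

Set Implicit Arguments.
Unset Strict Implicit.
Unset Printing Implicit Defensive.

Import Order.TTheory GRing.Theory Num.Theory.
Import numFieldNormedType.Exports.

Local Open Scope classical_set_scope.
Local Open Scope complex_scope.
Local Open Scope ring_scope.

(* The complex numbers are [R[i]], for [R : realType], and their topology is
   the norm topology every [numFieldType] carries. *)
#[export, non_forgetful_inheritance]
HB.instance Definition _ (R : realType) := PseudoPointedMetric.copy R[i] R[i]^o.

(* All rings are allowed to be zero, so that [X] may be empty. *)
Section Modules.
Context (A : pzRingType).

Definition finitely_generated (M : lmodType A) : Prop :=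
  exists (n : nat) (g : 'I_n -> M), forall m : M,
    exists a : 'I_n -> A, m = \sum_(i < n) a i *: g i.

Definition projective (P : lmodType A) : Prop :=
  forall (M N : lmodType A) (f : {linear M -> N}) (g : {linear P -> N}),
    (forall y : N, exists x : M, f x = y) ->
    exists h : {linear P -> M}, forall p : P, f (h p) = g p.

End Modules.

Section ContinuousFunctions.
Context (R : realType) (X : topologicalType).
Local Notation CX := (continuousType X R[i]).
Implicit Types f g h : CX.

Let zero_cts : continuous (fun _ : X => 0 : R[i]).
Proof. by move=> x; exact: cvg_cst. Qed.

Let one_cts : continuous (fun _ : X => 1 : R[i]).
Proof. by move=> x; exact: cvg_cst. Qed.

Let opp_cts f : continuous (fun x : X => - f x : R[i]).
Proof. by move=> x; apply: (@cvgN _ R[i]^o); exact: (@cts_fun _ _ f). Qed.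

Let add_cts f g : continuous (fun x : X => f x + g x : R[i]).
Proof.
by move=> x; apply: (@cvgD _ R[i]^o); [exact: (@cts_fun _ _ f)|exact: (@cts_fun _ _ g)].
Qed.

Let mul_cts f g : continuous (fun x : X => f x * g x : R[i]).
Proof.
by move=> x; apply: (@cvgM R[i]); [exact: (@cts_fun _ _ f)|exact: (@cts_fun _ _ g)].
Qed.

Definition ctsf_zero : CX := mkcts zero_cts.
Definition ctsf_one : CX := mkcts one_cts.
Definition ctsf_opp f : CX := mkcts (opp_cts (f := f)).
Definition ctsf_add f g : CX := mkcts (add_cts (f := f) (g := g)).
Definition ctsf_mul f g : CX := mkcts (mul_cts (f := f) (g := g)).

Let addA : associative ctsf_add.
Proof. by move=> f g h; apply/continuousEP => x /=; exact: addrA. Qed.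

Let addC : commutative ctsf_add.
Proof. by move=> f g; apply/continuousEP => x /=; exact: addrC. Qed.

Let add0 : left_id ctsf_zero ctsf_add.
Proof. by move=> f; apply/continuousEP => x /=; exact: add0r. Qed.

Let addN : left_inverse ctsf_zero ctsf_opp ctsf_add.
Proof. by move=> f; apply/continuousEP => x /=; exact: addNr. Qed.

HB.instance Definition _ := GRing.isZmodule.Build CX addA addC add0 addN.

Let mulA : associative ctsf_mul.
Proof. by move=> f g h; apply/continuousEP => x /=; exact: mulrA. Qed.

Let mulC : commutative ctsf_mul.
Proof. by move=> f g; apply/continuousEP => x /=; exact: mulrC. Qed.

Let mul1 : left_id ctsf_one ctsf_mul.
Proof. by move=> f; apply/continuousEP => x /=; exact: mul1r. Qed.

Let mulD : left_distributive ctsf_mul ctsf_add.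
Proof. by move=> f g h; apply/continuousEP => x /=; exact: mulrDl. Qed.

HB.instance Definition _ := GRing.Zmodule_isComPzRing.Build CX mulA mulC mul1 mulD.

End ContinuousFunctions.

(* A record rather than [sigT], whose canonical topology is that of the disjoint
   union. *)
Record total_space (R : realType) (X : Type)
  (F : X -> completeNormedModType R[i]) := Vec { base : X; vec : F base }.
Arguments Vec {R X F} base vec.

Record bundle_data (R : realType) (X : topologicalType) := BundleData {
  fiber : X -> completeNormedModType R[i];
  total_open : set_system (total_space fiber);
  total_openT : total_open setT;
  total_openI : setI_closed total_open;
  total_open_bigU : forall (I : Type) (f : I -> set (total_space fiber)),
    (forall i, total_open (f i)) -> total_open (\bigcup_i f i)
}.

Section Bundles.
Context (R : realType) (X : topologicalType).
Implicit Types B : bundle_data R X.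

Definition bundle_total B : Type := total_space (fiber B).

HB.instance Definition _ B := gen_eqMixin (bundle_total B).
HB.instance Definition _ B := gen_choiceMixin (bundle_total B).
HB.instance Definition _ B := isOpenTopological.Build (bundle_total B)
  (@total_openT _ _ B) (@total_openI _ _ B) (@total_open_bigU _ _ B).

Definition in_fiber B (x : X) (u : fiber B x) : bundle_total B := Vec x u.

Definition bundle_proj B (s : bundle_total B) : X := base s.

(* The norms of MathComp-Analysis take values in the scalar field [R[i]]. *)
Definition fnorm B (s : bundle_total B) : R := complex.Re `|vec s|.

(* The fiber product of the total space with itself over [X], topologized as a
   subspace of the square of the total space. *)
Definition fiber_pair B (p : {x : X & (fiber B x * fiber B x)%type}) :
    (bundle_total B * bundle_total B)%type :=
  (in_fiber (tagged p).1, in_fiber (tagged p).2).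

Definition fiber_square B : topologicalType := initial_topology (@fiber_pair B).

Definition fiber_add B (p : fiber_square B) : bundle_total B :=
  in_fiber ((tagged p).1 + (tagged p).2).

Definition fiber_scale B (p : R[i] * bundle_total B) : bundle_total B :=
  in_fiber (p.1 *: vec p.2).

Record is_banach_bundle B : Prop := {
  bundle_proj_continuous : continuous (@bundle_proj B);
  bundle_proj_open : forall U : set (bundle_total B),
    open U -> open (@bundle_proj B @` U);
  bundle_proj_surjective : forall x : X,
    exists s : bundle_total B, bundle_proj s = x;
  fiber_scale_continuous : continuous (@fiber_scale B);
  fiber_add_continuous : continuous (@fiber_add B);
  fnorm_usc : forall (s : bundle_total B) (a : R),
    fnorm s < a -> \forall t \near s, fnorm t < a;
  nbhs_fiber_zero : forall (x : X) (W : set (bundle_total B)),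
    nbhs (in_fiber (0 : fiber B x)) W <->
    exists U : set X, exists2 e : R, nbhs x U /\ 0 < e &
      [set s : bundle_total B | U (bundle_proj s) /\ fnorm s < e] `<=` W
}.

Record banach_bundle := BanachBundle {
  bundle_datum :> bundle_data R X;
  banach_bundleP : is_banach_bundle bundle_datum
}.

Definition continuous_bundle (E : banach_bundle) : Prop :=
  continuous (@fnorm E).

(* Only the restrictions of [phi] and [psi] to [U] matter. *)
Definition is_local_trivialization (E : banach_bundle) (U : set X)
    (E0 : completeNormedModType R[i])
    (phi : forall x, fiber E x -> E0) (psi : forall x, E0 -> fiber E x) : Prop :=
  [/\ forall x, U x -> linear (phi x),
      forall x, U x -> cancel (phi x) (psi x) /\ cancel (psi x) (phi x),
      {within @bundle_proj E @^-1` U, continuous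
        (fun s : bundle_total E => (bundle_proj s, phi (bundle_proj s) (vec s)))} &
      {within U `*` [set: E0], continuous
        (fun p : X * E0 => in_fiber (psi p.1 p.2))}].

Definition locally_trivial (E : banach_bundle) : Prop :=
  forall x : X, exists U : set X, [/\ open U, U x &
    exists (E0 : completeNormedModType R[i])
           (phi : forall y, fiber E y -> E0) (psi : forall y, E0 -> fiber E y),
      is_local_trivialization U phi psi].

(* Over the field [R[i]], finitely generated means finite-dimensional. *)
Definition finite_rank (E : banach_bundle) : Prop :=
  forall x : X, finitely_generated (fiber E x).

Record sections (E : banach_bundle) := MkSection {
  section_val :> forall x : X, fiber E x;
  section_continuous : continuous (fun x : X => in_fiber (section_val x))
}.

HB.instance Definition _ E := gen_eqMixin (sections E).
HB.instance Definition _ E := gen_choiceMixin (sections E).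

Section SectionModule.
Context (E : banach_bundle).
Implicit Types (s t u : sections E) (f g : continuousType X R[i]).

Lemma sectionP s t : (forall x, s x = t x) -> s = t.
Proof.
case: s t => [s sc] [t tc] /= st.
have {}st : s = t by exact: functional_extensionality_dep.
by subst t; congr MkSection; exact: Prop_irrelevance.
Qed.

Let zero_cts : continuous (fun x : X => in_fiber (0 : fiber E x)).
Proof.
move=> x W /(nbhs_fiber_zero (banach_bundleP E)) [U [e [Ux e0] UW]].
rewrite /nbhs /=; apply: (@filterS _ (nbhs x) _ U) => // y Uy.
by apply: UW; split => //; rewrite /fnorm /= normr0.
Qed.

Let add_cts s t : continuous (fun x : X => in_fiber (s x + t x)).
Proof.
pose st (x : X) : fiber_square E := existT _ x (s x, t x).
have stc : continuous st.
  apply: continuous_comp_initial => x.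
  exact: (cvg_pair (@section_continuous _ s x) (@section_continuous _ t x)).
move=> x; apply: (@continuous_comp _ _ _ st (@fiber_add E)); first exact: stc.
exact: (fiber_add_continuous (banach_bundleP E)).
Qed.

Let scale_cts f s : continuous (fun x : X => in_fiber (f x *: s x)).
Proof.
pose fs (x : X) : R[i] * bundle_total E := (f x, in_fiber (s x)).
have fsc : continuous fs.
  move=> x.
  exact: (cvg_pair (@cts_fun _ _ f x) (@section_continuous _ s x)).
move=> x; apply: (@continuous_comp _ _ _ fs (@fiber_scale E)); first exact: fsc.
exact: (fiber_scale_continuous (banach_bundleP E)).
Qed.

Let opp_cts s : continuous (fun x : X => in_fiber (- s x)).
Proof.
rewrite (_ : (fun x : X => _) = fun x : X => in_fiber ((- 1 : R[i]) *: s x)).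
  exact: (@scale_cts (- 1) s).
by apply/funext => x; rewrite scaleN1r.
Qed.

Definition section_zero : sections E := MkSection zero_cts.
Definition section_add s t : sections E := MkSection (@add_cts s t).
Definition section_opp s : sections E := MkSection (@opp_cts s).
Definition section_scale f s : sections E := MkSection (@scale_cts f s).

Let addA : associative section_add.
Proof. by move=> s t u; apply: sectionP => x /=; exact: addrA. Qed.

Let addC : commutative section_add.
Proof. by move=> s t; apply: sectionP => x /=; exact: addrC. Qed.

Let add0 : left_id section_zero section_add.
Proof. by move=> s; apply: sectionP => x /=; exact: add0r. Qed.

Let addN : left_inverse section_zero section_opp section_add.
Proof. by move=> s; apply: sectionP => x /=; exact: addNr. Qed.

HB.instance Definition _ :=
  GRing.isZmodule.Build (sections E) addA addC add0 addN.

Let scaleA f g s :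
  section_scale f (section_scale g s) = section_scale (f * g) s.
Proof. by apply: sectionP => x /=; exact: scalerA. Qed.

Let scale1 : left_id 1 section_scale.
Proof. by move=> s; apply: sectionP => x /=; exact: scale1r. Qed.

Let scaleDr : right_distributive section_scale +%R.
Proof. by move=> f s t; apply: sectionP => x /=; exact: scalerDr. Qed.

Let scaleDl s : {morph section_scale^~ s : f g / f + g}.
Proof. by move=> f g; apply: sectionP => x /=; exact: scalerDl. Qed.

HB.instance Definition _ := GRing.Zmodule_isLmodule.Build
  (continuousType X R[i]) (sections E) scaleA scale1 scaleDr scaleDl.

End SectionModule.

End Bundles.

(* Main.v *)
Require Import Defs.
From HB Require Import structures.
From mathcomp Require Import all_boot all_order all_algebra.
From mathcomp Require Import all_classical all_reals all_analysis.
From mathcomp Require Import complex.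
From mathcomp Require Import ring lra.

(* First, every vector of a fiber lies on a global section (Douady and
   dal Soglio-Herault): call a possibly discontinuous section [eps]-continuous
   at [x] if it stays within [eps] of all vectors near its value at [x]. Local
   choices inside thin open sets, glued by a partition of unity, improve the
   [eps] of such a section by a small uniform change, and the limit of the
   improvements is continuous.

   Let now the sections be generated by [s_1, ..., s_n], and lift a basis of the
   fiber at [x] to sections [t_1, ..., t_d]. By continuity of the norm and
   compactness of a sphere, the [t_i] stay uniformly independent near [x]. They
   also still span: [s_j] minus its combination of the [t_i] vanishes at [x],
   and a section [r] vanishing at [x] is [sqrt |r|] times a continuous section,
   hence a combination of the [s_k] whose coefficients vanish at [x]. So
   [(1 - C) s = A t] with [C(x) = 0], and [det (1 - C)] is nonzero near [x].

   The local frames so obtained trivialize the bundle; conversely a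
   trivialization gives local frames. Their coordinate functions, weighted by a
   partition of unity, form a dual basis of the module of sections. *)

Set Implicit Arguments.
Unset Strict Implicit.
Unset Printing Implicit Defensive.

Import Order.TTheory GRing.Theory Num.Theory.
Import numFieldNormedType.Exports.

Local Open Scope classical_set_scope.
Local Open Scope complex_scope.
Local Open Scope ring_scope.

(** * Real-valued norms and convergence in the total space *)

Section RealNorm.
Context {R : realType}.

Definition rnorm (V : normedZmodType R[i]) (v : V) : R := complex.Re `|v|.

Lemma rnormE (V : normedZmodType R[i]) (v : V) : `|v| = (rnorm v)%:C.
Proof. by rewrite /rnorm RRe_real// normr_real. Qed.

Section normedZmod.
Context {V : normedZmodType R[i]}.
Implicit Types u v : V.

Lemma rnorm_ge0 v : 0 <= rnorm v.
Proof. by rewrite -ler0c -rnormE. Qed.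

Lemma rnormD u v : rnorm (u + v) <= rnorm u + rnorm v.
Proof. by rewrite -lecR rmorphD/= -!rnormE ler_normD. Qed.

Lemma rnormN v : rnorm (- v) = rnorm v.
Proof. by rewrite /rnorm normrN. Qed.

Lemma rdistC u v : rnorm (u - v) = rnorm (v - u).
Proof. by rewrite -rnormN opprB. Qed.

Lemma rnormB u v : rnorm (u - v) <= rnorm u + rnorm v.
Proof. by rewrite -[rnorm v]rnormN rnormD. Qed.

Lemma rnorm0 : rnorm (0 : V) = 0.
Proof. by rewrite /rnorm normr0. Qed.

Lemma rnorm_eq0 v : (rnorm v == 0) = (v == 0).
Proof. by rewrite -(inj_eq (@complexI R)) -rnormE normr_eq0. Qed.

Lemma rnorm_gt0 v : (0 < rnorm v) = (v != 0).
Proof. by rewrite lt_def rnorm_ge0 andbT rnorm_eq0. Qed.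

Lemma rnorm_sum (I : Type) (r : seq I) (P : pred I) (f : I -> V) :
  rnorm (\sum_(i <- r | P i) f i) <= \sum_(i <- r | P i) rnorm (f i).
Proof.
elim/big_ind2 : _ => //; first by rewrite rnorm0.
by move=> a b c d ab cd; rewrite (le_trans (rnormD _ _))// lerD.
Qed.

End normedZmod.

Lemma rnormM (a b : R[i]) : rnorm (a * b) = rnorm a * rnorm b.
Proof. by apply: (@complexI R); rewrite rmorphM/= -!rnormE normrM. Qed.

Lemma rnorm_real (a : R) : rnorm (a%:C) = `|a|.
Proof. by apply: (@complexI R); rewrite -rnormE normc_def/= expr0n/= addr0 sqrtr_sqr. Qed.

Lemma rnormV (a : R[i]) : rnorm a^-1 = (rnorm a)^-1.
Proof.
have [->|a0] := eqVneq a 0; first by rewrite !(invr0, rnorm0).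
apply: (@mulfI _ (rnorm a)); first by rewrite rnorm_eq0.
rewrite -rnormM !divff ?rnorm_eq0//.
by rewrite (_ : 1 = 1%:C)// rnorm_real normr1.
Qed.

Lemma rnormZ (V : normedModType R[i]) (a : R[i]) (v : V) :
  rnorm (a *: v) = rnorm a * rnorm v.
Proof. by apply: (@complexI R); rewrite rmorphM/= -!rnormE normrZ. Qed.

(** A positive element of [R[i]] is real, so real radii suffice to test convergence. *)
Lemma cvg_rnormP {V : normedModType R[i]} {Z : Type} (F : set_system Z)
    {FF : Filter F} (f : Z -> V) (v : V) :
  f @ F --> v <-> forall e : R, 0 < e -> \forall z \near F, rnorm (v - f z) < e.
Proof.
split=> [/cvgrPdist_lt fv e e0|fv].
  have /fv : 0 < e%:C by rewrite ltcR.
  by apply: filterS => z; rewrite rnormE ltcR.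
apply/cvgrPdist_lt => e e0.
have eE : e = (complex.Re e)%:C by rewrite RRe_real// gtr0_real.
have /fv : 0 < complex.Re e by rewrite -ltcR -eE.
by apply: filterS => z; rewrite rnormE eE ltcR.
Qed.

Lemma real_complex_continuous : continuous (fun a : R => a%:C : R[i]).
Proof.
move=> a; apply/(@cvg_rnormP R[i]^o) => e e0.
have /cvgrPdist_lt/(_ e e0) : (id : R -> R) @ a --> a by exact: cvg_id.
by apply: filterS => b; rewrite -rmorphB rnorm_real.
Qed.

End RealNorm.

Section BundleCalculus.
Context {R : realType} {X : topologicalType} (E : banach_bundle R X).

Section Filters.
Context {Z : Type} (F : set_system Z) {FF : Filter F} (b : Z -> X) (x : X).
Implicit Types (f g : forall z, fiber E (b z)) (u v : fiber E x).

Lemma cvg_base f u : (fun z => in_fiber (f z)) @ F --> in_fiber u -> b @ F --> x.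
Proof.
move=> fu; have := bundle_proj_continuous (banach_bundleP E) (x := in_fiber u).
exact: cvg_comp fu.
Qed.

(** Addition is continuous on the fiber product only, so the pair is first shown to converge there,
    in the topology induced from the square of the total space. *)
Lemma cvg_fiber_add f g u v :
  (fun z => in_fiber (f z)) @ F --> in_fiber u ->
  (fun z => in_fiber (g z)) @ F --> in_fiber v ->
  (fun z => in_fiber (f z + g z)) @ F --> in_fiber (u + v).
Proof.
move=> fu gv.
pose fg z : fiber_square E := existT _ (b z) (f z, g z).
have fguv : fg @ F --> (existT _ x (u, v) : fiber_square E).
  move=> U [?/= [[W oW <-]]] /= Wuv /filterS; apply.
  have : nbhs (in_fiber u, in_fiber v) W by exact: open_nbhs_nbhs.
  exact: (cvg_pair fu gv).
have := fiber_add_continuous (banach_bundleP E)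
  (x := existT _ x (u, v) : fiber_square E).
exact: cvg_comp fguv.
Qed.

Lemma cvg_fiber_scale (c : Z -> R[i]) (k : R[i]) f u : c @ F --> k ->
  (fun z => in_fiber (f z)) @ F --> in_fiber u ->
  (fun z => in_fiber (c z *: f z)) @ F --> in_fiber (k *: u).
Proof.
move=> ck fu.
have := fiber_scale_continuous (banach_bundleP E) (x := (k, in_fiber u)).
exact: (cvg_comp _ _ (cvg_pair ck fu)).
Qed.

Lemma cvg_fiber_opp f u : (fun z => in_fiber (f z)) @ F --> in_fiber u ->
  (fun z => in_fiber (- f z)) @ F --> in_fiber (- u).
Proof.
move=> fu; rewrite -scaleN1r.
under eq_fun do rewrite -scaleN1r.
by apply: cvg_fiber_scale => //; exact: cvg_cst.
Qed.

Lemma cvg_fiber_sub f g u v :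
  (fun z => in_fiber (f z)) @ F --> in_fiber u ->
  (fun z => in_fiber (g z)) @ F --> in_fiber v ->
  (fun z => in_fiber (f z - g z)) @ F --> in_fiber (u - v).
Proof. by move=> fu gv; apply: cvg_fiber_add => //; exact: cvg_fiber_opp. Qed.

Lemma near_rnorm_lt f u (a : R) :
  (fun z => in_fiber (f z)) @ F --> in_fiber u -> rnorm u < a ->
  \forall z \near F, rnorm (f z) < a.
Proof. move=> fu ua.
exact: fu (fnorm_usc (banach_bundleP E) (s := in_fiber u) ua). Qed.

(** The tubes of small norm over neighborhoods of [x] form a neighborhood basis of the zero
    vector. *)
Lemma cvg_fiber0 f : b @ F --> x ->
  (forall e : R, 0 < e -> \forall z \near F, rnorm (f z) < e) ->
  (fun z => in_fiber (f z)) @ F --> in_fiber (0 : fiber E x).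
Proof.
move=> bx f0 W /(nbhs_fiber_zero (banach_bundleP E)) [U [e [Ux e0] UW]].
near=> z; apply: UW; split; first by near: z; exact: bx.
by near: z; exact: f0.
Unshelve. all: by end_near. Qed.

Lemma cvg_fiber_zero : b @ F --> x ->
  (fun z => in_fiber (0 : fiber E (b z))) @ F --> in_fiber (0 : fiber E x).
Proof.
by move=> bx; apply: cvg_fiber0 => // e e0; apply: nearW => z; rewrite rnorm0.
Qed.

Lemma cvg_fiber_sum (I : Type) (r : seq I)
    (f : I -> forall z, fiber E (b z)) (u : I -> fiber E x) :
  b @ F --> x ->
  (forall i, (fun z => in_fiber (f i z)) @ F --> in_fiber (u i)) ->
  (fun z => in_fiber (\sum_(i <- r) f i z)) @ F --> in_fiber (\sum_(i <- r) u i).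
Proof.
move=> bx fu; elim: r => [|i r IH].
  rewrite big_nil; under eq_fun do rewrite big_nil.
  exact: cvg_fiber_zero.
rewrite big_cons; under eq_fun do rewrite big_cons.
exact: cvg_fiber_add.
Qed.

End Filters.

(** This is the identity of the total space, written in the shape that the convergence lemmas above
    expect. *)
Lemma cvg_total (x : X) (u : fiber E x) :
  (fun w : bundle_total E => in_fiber (vec w)) @ in_fiber u --> in_fiber u.
Proof.
rewrite (_ : (fun w => _) = id); first exact: cvg_id.
by apply/funext; case.
Qed.

Lemma near_proj (x : X) (u : fiber E x) (S : set (bundle_total E)) :
  nbhs (in_fiber u) S ->
  \forall y \near x, exists a : fiber E y, S (in_fiber a).
Proof.
rewrite nbhsE => -[S' [oS' S'u] S'S].
have : nbhs x (@bundle_proj _ _ E @` S').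
  apply: open_nbhs_nbhs; split; last by exists (in_fiber u).
  exact: (bundle_proj_open (banach_bundleP E)).
by apply: filterS => _ [[y a] S'a <-]; exists a; apply: S'S.
Qed.

Lemma near_proj_total (x : X) (u : fiber E x) (P : set X) :
  nbhs x P -> \forall w \near in_fiber u, P (base w).
Proof. exact: (bundle_proj_continuous (banach_bundleP E) (x := in_fiber u)). Qed.

Lemma nbhs_fiber_square (x : X) (s t : fiber E x) (P : set (fiber_square E)) :
  nbhs (existT _ x (s, t) : fiber_square E) P ->
  exists S T : set (bundle_total E), [/\ nbhs (in_fiber s) S,
    nbhs (in_fiber t) T & forall y (a b : fiber E y),
      S (in_fiber a) -> T (in_fiber b) -> P (existT _ y (a, b))].
Proof.
move=> [?/= [[W oW <-]]] /= Wst WP.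
have : nbhs (in_fiber s, in_fiber t) W by exact: open_nbhs_nbhs.
move=> [[/= S T] [Ss Tt] STW]; exists S, T; split => // y a b Sa Tb.
by apply: WP; apply: STW.
Qed.

(** Openness of the projection supplies, over the base point of every [w] near [t], a companion
    vector [a] near [s]. *)
Lemma near_lift (x : X) (s t : fiber E x) (S : set (bundle_total E))
    (P : set (fiber_square E)) :
  nbhs (in_fiber s) S -> nbhs (existT _ x (s, t) : fiber_square E) P ->
  \forall w \near in_fiber t, exists a : fiber E (base w),
    S (in_fiber a) /\ P (existT _ (base w) (a, vec w)).
Proof.
move=> Ss /nbhs_fiber_square [A [B [As Bt ABP]]].
have ASt : \forall w \near in_fiber t, exists a : fiber E (base w),
    (S `&` A) (in_fiber a).
  exact: (near_proj_total t (near_proj (filterI Ss As))).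
apply: filterS2 ASt Bt => w [a [Sa Aa]] Bw.
by exists a; split => //; apply: ABP => //; case: (w) Bw.
Qed.

Lemma cvg_pair1 (x : X) (s t : fiber E x) :
  (fun p : fiber_square E => in_fiber (tagged p).1) @
    (existT _ x (s, t) : fiber_square E) --> in_fiber s.
Proof.
have st := @initial_continuous _ _ (@fiber_pair _ _ E) (existT _ x (s, t)).
exact: (cvg_comp _ _ st (@cvg_fst _ _ _ _ _)).
Qed.

Lemma cvg_pair2 (x : X) (s t : fiber E x) :
  (fun p : fiber_square E => in_fiber (tagged p).2) @
    (existT _ x (s, t) : fiber_square E) --> in_fiber t.
Proof.
have st := @initial_continuous _ _ (@fiber_pair _ _ E) (existT _ x (s, t)).
exact: (cvg_comp _ _ st (@cvg_snd _ _ _ _ _)).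
Qed.

(** Splits a moving vector near [t] into [c a] with [a] near [s] and a remainder near [t - c(x) s].
    With [c = 1] this handles sums, and with zero remainder at [x] it handles multiples. *)
Lemma near_lift_sub (x : X) (s t : fiber E x) (c : X -> R[i])
    (S T : set (bundle_total E)) : {for x, continuous c} ->
  nbhs (in_fiber s) S -> nbhs (in_fiber (t - c x *: s)) T ->
  \forall w \near in_fiber t, exists a : fiber E (base w),
    S (in_fiber a) /\ T (in_fiber (vec w - c (base w) *: a)).
Proof.
move=> cx Ss Tst.
have p1 := @cvg_pair1 x s t; have p2 := @cvg_pair2 x s t.
have cp := cvg_comp _ _ (cvg_base p1) cx.
pose P (p : fiber_square E) := T (in_fiber ((tagged p).2 - c (tag p) *: (tagged p).1)).
have Pst : nbhs (existT _ x (s, t) : fiber_square E) P.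
  exact: (cvg_fiber_sub p2 (cvg_fiber_scale cp p1)) Tst.
exact: (near_lift Ss Pst).
Qed.

End BundleCalculus.

(** * Sections through given vectors *)

Section ApproximateSections.
Context {R : realType} {X : topologicalType} (E : banach_bundle R X).

(* Up to [eps], all vectors near [s] agree with the arbitrary section [f]; since
   the [s] involved is mostly [f x], this measures the discontinuity of [f] at
   [x]. *)
Definition approx_section (f : forall y, fiber E y) (x : X) (s : fiber E x) (eps : R) :=
  forall eta : R, 0 < eta ->
    \forall w \near in_fiber s, rnorm (vec w - f (base w)) < eps + eta.

Lemma approx_section_le f x s (a b : R) :
  a <= b -> @approx_section f x s a -> approx_section f s b.
Proof.
move=> ab fa eta eta0; apply: filterS (fa _ eta0) => w /lt_le_trans; apply.
by rewrite lerD2r.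
Qed.

Lemma approx_sectionD f g x s t (a b : R) :
  @approx_section f x s a -> @approx_section g x t b ->
  approx_section (fun y => f y + g y) (s + t) (a + b).
Proof.
move=> fs gt eta eta0.
have e2 : 0 < eta / 2 by rewrite divr_gt0.
have Tst : nbhs (in_fiber (s + t - (1 : R[i]) *: s))
    [set w | rnorm (vec w - g (base w)) < b + eta / 2].
  by rewrite scale1r addrC addKr; exact: gt.
have c1 : {for x, continuous (fun _ : X => 1 : R[i])} by exact: cvg_cst.
apply: filterS (near_lift_sub c1 (fs _ e2) Tst) => w [u []] /=.
rewrite scale1r => fu gu.
have -> : vec w - (f (base w) + g (base w)) =
    (u - f (base w)) + (vec w - u - g (base w)).
  by rewrite [RHS]addrACA [u + _]addrC subrK opprD.
apply: le_lt_trans (rnormD _ _) _; rewrite /fnorm in fu gu.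
by have := ltrD fu gu; congr (_ < _); lra.
Qed.

(** A vector near [c(x) s] is [c u] up to a small remainder, with [u] near [s]. No division by [c]
    occurs, so zeros of [c] are allowed; gluing relies on this. *)
Lemma approx_sectionZ (c : X -> R[i]) f x s (a : R) : {for x, continuous c} -> 0 <= a ->
  @approx_section f x s a ->
  approx_section (fun y => c y *: f y) (c x *: s) (rnorm (c x) * a).
Proof.
move=> cx a0 fs eta eta0.
have n0 := rnorm_ge0 (c x).
(* With [e1 <= 1], both [rnorm (c x) * e1] and [e2 * (a + e1)] are at most [eta / 3]; the remainder
   takes the last third. *)
pose e1 := Num.min 1 (eta / (3 * (rnorm (c x) + 1))).
have e10 : 0 < e1 by rewrite lt_min ltr01 divr_gt0// mulr_gt0// ltr_wpDl.
have e11 : e1 <= 1 by rewrite ge_min lexx.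
have e1c : (rnorm (c x) + 1) * e1 <= eta / 3.
  rewrite mulrC -ler_pdivlMr ?ltr_wpDl// ge_min; apply/orP; right.
  by rewrite -mulrA -invfM.
pose e2 := eta / (3 * (a + 1)).
have e20 : 0 < e2 by rewrite divr_gt0// mulr_gt0// ltr_wpDl.
have e2a : e2 * (a + 1) = eta / 3.
  by rewrite /e2; field; rewrite gt_eqF// ltr_wpDl.
have T0 : nbhs (in_fiber (c x *: s - c x *: s))
    [set w : bundle_total E | rnorm (vec w) < eta / 3].
  have eta3 : 0 < eta / 3 by rewrite divr_gt0.
  have := near_rnorm_lt (@cvg_total _ _ E x 0) _.
  by rewrite rnorm0 subrr; apply.
have cn : \forall w \near in_fiber (c x *: s), rnorm (c (base w)) < rnorm (c x) + e2.
  apply: (@near_proj_total _ _ E x (c x *: s) (fun y => rnorm (c y) < rnorm (c x) + e2)).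
  move/(@cvg_rnormP _ R[i]^o) : cx => /(_ _ e20); apply: filterS => y cxy.
  rewrite -[c y](subrK (c x)); apply: le_lt_trans (rnormD _ _) _.
  by rewrite addrC ltrD2l rdistC.
apply: filterS2 (near_lift_sub cx (fs _ e10) T0) cn => w [u []] /= fu gu cw.
have -> : vec w - c (base w) *: f (base w) =
    (vec w - c (base w) *: u) + c (base w) *: (u - f (base w)).
  by rewrite scalerBr addrA subrK.
apply: le_lt_trans (rnormD _ _) _; rewrite rnormZ.
rewrite /fnorm/= in fu.
have := rnorm_ge0 (u - f (base w)); have := rnorm_ge0 (c (base w)).
set p := rnorm (c (base w)) in cw *; set q := rnorm (u - _) in fu *.
move=> p0 q0.
have : p * q <= (rnorm (c x) + e2) * (a + e1) by apply: ler_pM => //; exact: ltW.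
move: gu e1c e2a e11; set r := rnorm _; set m := rnorm (c x) in n0 *.
nra.
Qed.

(** A crude bound from upper semicontinuity of the norm. It serves for terms whose weight vanishes
    at [x], for uniformly small corrections, and to start the iteration. *)
Lemma approx_section_bounded f x s (M N : R) : (forall y, rnorm (f y) <= M) ->
  rnorm s <= N -> @approx_section f x s (N + M).
Proof.
move=> fM sN eta eta0.
have /(near_rnorm_lt (@cvg_total _ _ E x s)) : rnorm s < N + eta by lra.
apply: filterS => w /= wN; apply: le_lt_trans (rnormB _ _) _.
by have := fM (base w); lra.
Qed.

Lemma approx_section_sum (I : Type) (r : seq I) (f : I -> forall y, fiber E y) x
    (s : I -> fiber E x) (a : I -> R) : (forall i, approx_section (f i) (s i) (a i)) ->
  approx_section (fun y => \sum_(i <- r) f i y) (\sum_(i <- r) s i) (\sum_(i <- r) a i).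
Proof.
move=> fsa; elim: r => [|i r IH].
  rewrite !big_nil -[0 : R]addr0; apply: approx_section_bounded; rewrite ?rnorm0//.
  by move=> y; rewrite big_nil rnorm0.
have := approx_sectionD (fsa i) IH; rewrite !big_cons => H eta eta0.
by apply: filterS (H _ eta0) => w; rewrite big_cons.
Qed.

(** Over [y] near [x] there is a vector [a] near [f x] with [f y - a] small; continuity of addition
    at [(f x, 0)] then puts [f y = a + (f y - a)] near [f x]. *)
Lemma approx_section_cvg f x : (forall e : R, 0 < e -> approx_section f (f x) e) ->
  (fun y => in_fiber (f y)) @ x --> in_fiber (f x).
Proof.
move=> fx W Wx.
have add := cvg_fiber_add (@cvg_pair1 _ _ _ x (f x) 0) (@cvg_pair2 _ _ _ x (f x) 0).
rewrite addr0 in add.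
have [S [T [Sf]]] := nbhs_fiber_square (add (nbhs_filter _) _ Wx).
move=> /(nbhs_fiber_zero (banach_bundleP E)) [U [e [Ux e0] UT]] STW.
have e2 : 0 < e / 2 by rewrite divr_gt0.
have near_a : \forall y \near x, exists a : fiber E y, (S `&` [set w : bundle_total E |
    rnorm (vec w - f (base w)) < e / 2 + e / 2]) (in_fiber a).
  by apply: (near_proj (u := f x)); apply: filterI Sf _; exact: fx.
rewrite /= nbhs_filterE /=; apply: filterS2 Ux near_a => y Uy [a [Sa /= fa]].
have := STW y a (f y - a) Sa; rewrite /= [a + _]addrC subrK; apply.
by apply: UT; split => //; rewrite /fnorm -/(rnorm _) rdistC; lra.
Qed.

End ApproximateSections.

(** * Partitions of unity on a compact Hausdorff space *)

Section PartitionOfUnity.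
Context {R : realType} {X : topologicalType}.
Hypotheses (compactX : compact [set: X]) (hausdorffX : hausdorff_space X).

(** Urysohn's lemma separates [x] from the complement of an open neighborhood inside [V]. *)
Lemma bump_function (x : X) (V : set X) : nbhs x V ->
  exists h : X -> R, [/\ continuous h, forall y, 0 <= h y, h x = 1 &
    forall y, h y != 0 -> V y].
Proof.
rewrite nbhsE => -[U [oU Ux] UV].
have clx : closed [set x].
  by apply: accessible_closed_set1; exact: hausdorff_accessible.
have /(@normal_separatorP R) sepX := compact_normal hausdorffX compactX.
have Ux0 : ~` U `&` [set x] = set0.
  by rewrite -subset0 => y [nUy xy]; apply: nUy; rewrite xy.
have /(@uniform_separatorP _ R)[h [ch h01 hU hx]] := sepX _ _ (open_closedC oU) clx Ux0.
exists h; split => // [y||y hy].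
- by have := h01 (h y) (ex_intro2 _ _ y I erefl); rewrite /= in_itv/= => /andP[].
- exact: (imsub1 hx).
- by apply: UV; apply: contrapT => nUy; case/eqP: hy; exact: (imsub1 hU).
Qed.

Lemma partition_of_unity (V : X -> set X) : (forall x, nbhs x (V x)) ->
  exists (n : nat) (p : 'I_n -> X) (h : 'I_n -> X -> R),
    [/\ forall i, continuous (h i), forall i y, 0 <= h i y,
        forall i y, h i y != 0 -> V (p i) y &
        forall y, \sum_(i < n) h i y = 1].
Proof.
move=> nV; have [h Hh] := choice (fun x => bump_function (nV x)).
pose U x := [set y | 2^-1 < h x y].
have oU x : open (U x).
  have [ch _ _ _] := Hh x.
  rewrite (_ : U x = h x @^-1` [set r | 2^-1 < r])//.
  by apply: open_comp => [y _|]; [exact: ch|exact: open_gt].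
(* Compactness is used in its near-covering form: along the filter of finite lists ordered by
   inclusion, it produces one list whose sets [U x] cover [X]. *)
pose F := filter_from [set: seq X] (fun r0 => [set r : seq X | {subset r0 <= r}]).
have FF : Filter F.
  apply: filter_from_filter; first by exists [::].
  by move=> r s _ _; exists (r ++ s) => // t rst; split => z zr; apply: rst;
    rewrite mem_cat zr ?orbT.
have [|r0 _ /(_ r0) r0cov] := (compact_near_coveringP _).1 compactX _ F
    (fun r y => exists2 x, x \in r & U x y) FF.
  move=> x _; exists (U x, [set r : seq X | {subset [:: x] <= r}]).
    split; last by exists [:: x].
    apply: open_nbhs_nbhs; split; first exact: oU.
    have [_ _ hx _] := Hh x.
    by rewrite /U/= hx; lra.
  by move=> [y r] [/= Uy xr]; exists x => //; apply: xr; rewrite inE.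
pose r := in_tuple r0.
pose S y : R := \sum_(i < size r0) h (tnth r i) y.
have S0 y : 0 < S y.
  have [//|x xr Uxy] := r0cov _ y I.
  have /tnthP[i xi] : x \in r by [].
  rewrite /S (bigD1 i)//= -xi ltr_pwDl//; first by apply: lt_trans Uxy; lra.
  by apply: sumr_ge0 => j _; have [_ + _ _] := Hh (tnth r j); exact.
have cS : continuous S.
  move=> y; apply: cvg_big => [|i _]; first exact: add_continuous.
  by have [+ _ _ _] := Hh (tnth r i); exact.
exists _, (tnth r), (fun i y => h (tnth r i) y / S y); split.
- move=> i y; apply: cvgM; first by have [+ _ _ _] := Hh (tnth r i); exact.
  by apply: cvgV; [rewrite gt_eqF|exact: cS].
- move=> i y; apply: divr_ge0; last exact: ltW.
  by have [_ h0 _ _] := Hh (tnth r i); exact: h0.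
- move=> i y; rewrite mulf_eq0 negb_or => /andP[hy _].
  by have [_ _ _ hV] := Hh (tnth r i); exact: hV.
- by move=> y; rewrite -mulr_suml -/(S y) divff// gt_eqF.
Qed.

End PartitionOfUnity.

(** * Limits of sequences with geometrically decreasing steps *)

Section GeometricLimit.
Context {R : realType}.

Lemma div_exp2_lt (C e : R) : 0 < e -> exists n : nat, C / 2 ^+ n < e.
Proof.
move=> e0; exists (Num.truncn (C / e)).
rewrite ltr_pdivrMr ?exprn_gt0// mulrC -ltr_pdivrMr//.
apply: lt_le_trans (truncnS_gt _) _.
by rewrite -natrX ler_nat ltn_expl.
Qed.

Lemma geometric_limit (V : completeNormedModType R[i]) (u : nat -> V) (C : R) :
  (forall n, rnorm (u n.+1 - u n) <= C / 2 ^+ n) ->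
  exists l : V, forall n, rnorm (l - u n) <= 2 * C / 2 ^+ n.
Proof.
move=> uC.
have pow_gt0 n : 0 < (2 : R) ^+ n by rewrite exprn_gt0.
have C0 : 0 <= C by have := uC 0; have := rnorm_ge0 (u 1 - u 0); rewrite expr0; lra.
(* Subtracting the remaining geometric tail makes the induction on [k] close. *)
have tail n k : rnorm (u (n + k)%N - u n) <= 2 * C / 2 ^+ n - 2 * C / 2 ^+ (n + k)%N.
  elim: k => [|k IH]; first by rewrite addn0 !subrr rnorm0.
  rewrite addnS -(subrK (u (n + k)%N) (u _.+1)) -addrA.
  apply: le_trans (rnormD _ _) _; apply: le_trans (lerD (uC _) IH) _.
  rewrite exprS invfM; set q := (2 ^+ (n + k))^-1; lra.
have tail' n m : (n <= m)%N -> rnorm (u m - u n) <= 2 * C / 2 ^+ n.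
  move=> /subnKC <-; apply: le_trans (tail _ _) _.
  by rewrite lerBlDr lerDl divr_ge0 ?mulr_ge0// ltW.
have /cauchy_cvgP ul : cauchy (u @ \oo).
  apply: cauchy_exP => e e0.
  have eE : e = (complex.Re e)%:C by rewrite RRe_real// gtr0_real.
  have e0' : 0 < complex.Re e by rewrite -ltcR -eE.
  have [n nC] := div_exp2_lt (2 * C) e0'.
  exists (u n), n => // m /= /tail' mn.
  rewrite -ball_normE/= rnormE eE ltcR rdistC; exact: le_lt_trans nC.
exists (lim (u @ \oo)) => n; apply/ler_addgt0Pr => e e0.
have [N _ Nl] := (cvg_rnormP _ _).1 ul e e0.
rewrite -(subrK (u (maxn N n)) (lim _)) -addrA addrC.
apply: le_trans (rnormD _ _) _; apply: lerD; first by apply: tail'; exact: leq_maxr.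
by apply: ltW; apply: Nl; exact: leq_maxl.
Qed.

End GeometricLimit.

(** * Improving approximately continuous sections *)

Section EnoughSections.
Context {R : realType} {X : topologicalType} (E : banach_bundle R X).
Hypotheses (compactX : compact [set: X]) (hausdorffX : hausdorff_space X).

(** Subtraction is continuous at [(u, u)], where its value is zero, and the norm is upper
    semicontinuous. *)
Lemma near_thin (x : X) (u : fiber E x) (e : R) : 0 < e ->
  exists2 W : set (bundle_total E), nbhs (in_fiber u) W &
    forall y (a b : fiber E y), W (in_fiber a) -> W (in_fiber b) ->
      rnorm (a - b) < e.
Proof.
move=> e0.
have p1 := @cvg_pair1 _ _ E x u u; have p2 := @cvg_pair2 _ _ E x u u.
have sub : \forall p \near (existT _ x (u, u) : fiber_square E),
    rnorm ((tagged p).1 - (tagged p).2) < e.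
  by apply: near_rnorm_lt (cvg_fiber_sub p1 p2) _; rewrite subrr rnorm0.
have [S [T [Su Tu ST]]] := nbhs_fiber_square sub.
by exists (S `&` T); [exact: filterI|move=> y a b [Sa _] [_ Tb]; exact: ST].
Qed.

(** Over the projection [V] of a thin open set [W] around [f x], let [g] pick vectors of [W]:
    thinness makes [g] [b]-continuous on [V]. Off [V], [g] is zero, which keeps it globally
    bounded. *)
Lemma approx_section_local (x0 : X) (f : forall y, fiber E y) (a b : R) (x : X) :
  0 < a -> 0 < b -> approx_section f (f x) a ->
  exists (V : set X) (g : forall y, fiber E y) (M : R),
    [/\ nbhs x V, forall y, rnorm (g y) <= M,
        forall y, V y -> rnorm (g y - f y) <= 2 * a,
        forall y, V y -> approx_section g (g y) b &
        V x0 -> g x0 = f x0].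
Proof.
move=> a0 b0 fx; pose M := rnorm (f x) + 1.
have [T Tx Tthin] := near_thin (f x) b0.
have Mx : \forall w \near in_fiber (f x), rnorm (vec w) < M.
  by apply: near_rnorm_lt (@cvg_total _ _ E x (f x)) _; rewrite /M; lra.
(* Shrinking [W] so that it meets the fiber over [x0] only if [x = x0] ensures that [g] may keep the
   value [f x0], which is then the center of [W]. *)
have x0x : \forall y \near x, y = x0 -> x = x0.
  have [->|xx0] := pselect (x = x0); first exact: nearW.
  have clx0 : closed [set x0].
    by apply: accessible_closed_set1; exact: hausdorff_accessible.
  have : nbhs x (~` [set x0]) by apply: open_nbhs_nbhs; split => //; exact: closed_openC.
  by apply: filterS => y yx0 /yx0.
(* The bound [a + a] is the approximation property of [f] taken at [eta = a]. *)
have [W [oW Wx] WP] : exists2 W : set (bundle_total E), open_nbhs (in_fiber (f x)) W &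
    W `<=` [set w | [/\ T w, rnorm (vec w - f (base w)) < a + a, rnorm (vec w) < M &
      (base w = x0 -> x = x0)]].
  suff : nbhs (in_fiber (f x)) [set w | [/\ T w,
    rnorm (vec w - f (base w)) < a + a, rnorm (vec w) < M &
    (base w = x0 -> x = x0)]] by rewrite nbhsE.
  have H : nbhs (in_fiber (f x)) [set w | base w = x0 -> x = x0].
    exact: (near_proj_total (f x) x0x).
  apply: filterS2 (filterI Tx Mx) (filterI (fx _ a0) H).
  by move=> w [Tw Mw] [fw x0w]; split.
pose V y := exists u : fiber E y, W (in_fiber u).
have gP y : exists u : fiber E y, (V y -> W (in_fiber u) /\ (y = x0 -> u = f y)) /\
    (~ V y -> u = 0).
  have [Vy|nVy] := pselect (V y); last by exists 0; split.
  have [yx0|yx0] := pselect (y = x0).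
    exists (f y); split => // _; split => //.
    have [u Wu] := Vy; have [_ _ _ /(_ yx0) xx0] := WP _ Wu.
    by rewrite yx0 -xx0.
  by have [u Wu] := Vy; exists u; split.
pose g y := sval (cid (gP y)).
have gV y : V y -> W (in_fiber (g y)) by move=> Vy; have [[]] := svalP (cid (gP y)).
exists V, g, M; split.
- exact: (near_proj (open_nbhs_nbhs (conj oW Wx))).
- move=> y; have [Vy|nVy] := pselect (V y).
    by have [_ _ /ltW] := WP _ (gV _ Vy).
  have [_ /(_ nVy) gy0] := svalP (cid (gP y)).
  by rewrite /g gy0 rnorm0 addr_ge0// rnorm_ge0.
- by move=> y /gV/WP[_ + _ _] => /ltW/le_trans; apply; lra.
- move=> y /gV Wgy eta eta0.
  have : nbhs (in_fiber (g y)) W by exact: open_nbhs_nbhs.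
  apply: filterS => -[z u] Wu /=.
  have Wg : W (in_fiber (g z)) by apply: gV; exists u.
  have [Tu _ _ _] := WP _ Wu; have [Tg _ _ _] := WP _ Wg.
  by apply: lt_trans (Tthin _ _ _ Tu Tg) _; rewrite ltrDl.
- by move=> Vx0; have [[] // _ /(_ erefl)] := svalP (cid (gP x0)).
Qed.

(** Local improvements are glued by convex combinations, which preserve the bound [2 * a], the value
    at [x0] and, at each point, the error [b] of the active pieces. *)
Lemma approx_section_step (x0 : X) (f : forall y, fiber E y) (a b : R) :
  0 < a -> 0 < b -> (forall x, approx_section f (f x) a) ->
  exists f' : forall y, fiber E y, [/\ f' x0 = f x0,
    forall x, approx_section f' (f' x) b & forall x, rnorm (f' x - f x) <= 2 * a].
Proof.
move=> a0 b0 fa.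
pose Q (x : X) (t : set X * ((forall y, fiber E y) * R)) := [/\ nbhs x t.1,
  forall y, rnorm (t.2.1 y) <= t.2.2,
  forall y, t.1 y -> rnorm (t.2.1 y - f y) <= 2 * a,
  forall y, t.1 y -> approx_section t.2.1 (t.2.1 y) b &
  t.1 x0 -> t.2.1 x0 = f x0].
have QP x : exists t, Q x t.
  have [V [g [M H]]] := approx_section_local x0 a0 b0 (fa x).
  by exists (V, (g, M)).
have [t tQ] := choice QP.
have [|n [p [h [ch h0 hV h1]]]] := partition_of_unity (R := R) compactX hausdorffX
    (V := fun x => (t x).1).
  by move=> x; have [] := tQ x.
have h1C y : \sum_(i < n) (h i y)%:C = 1 by rewrite -rmorph_sum/= h1.
pose g i := (t (p i)).2.1.
have hV0 i y : ~ (t (p i)).1 y -> h i y = 0.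
  by move=> nV; apply/eqP/negPn/negP => /hV.
have rh i y : rnorm ((h i y)%:C) = h i y by rewrite rnorm_real ger0_norm.
exists (fun y => \sum_(i < n) (h i y)%:C *: g i y); split.
- transitivity (\sum_(i < n) (h i x0)%:C *: f x0); last first.
    by rewrite -scaler_suml h1C scale1r.
  apply: eq_bigr => i _; have [Vi|nV] := pselect ((t (p i)).1 x0).
    by have [_ _ _ _ gx0] := tQ (p i); rewrite /g gx0.
  by rewrite (hV0 _ _ nV) !scale0r.
- move=> x.
  (* A piece whose set misses [x] has weight zero at [x], so any finite error will do for it. *)
  pose e i : R := if pselect ((t (p i)).1 x) then b else
    (t (p i)).2.2 + (t (p i)).2.2.
  apply: (approx_section_le (a := \sum_(i < n) rnorm ((h i x)%:C) * e i)).
    have -> : b = \sum_(i < n) h i x * b by rewrite -mulr_suml h1 mul1r.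
    apply: ler_sum => i _; rewrite rh /e.
    by case: pselect => // nV; rewrite (hV0 _ _ nV) !mul0r.
  apply: (@approx_section_sum _ _ E _ _ (fun i y => (h i y)%:C *: g i y)) => i.
  apply: (@approx_sectionZ _ _ E (fun y => (h i y)%:C)).
  + exact: (cvg_comp _ _ (ch i x) (@real_complex_continuous _ _)).
  + rewrite /e; case: pselect => Vx; first exact: ltW.
    have [_ M _ _ _] := tQ (p i).
    by apply: addr_ge0; exact: le_trans (rnorm_ge0 _) (M x).
  + have [_ M _ gb _] := tQ (p i).
    rewrite /e; case: pselect => Vx; first exact: gb.
    by apply: approx_section_bounded.
- move=> x.
  have -> : \sum_(i < n) (h i x)%:C *: g i x - f x =
      \sum_(i < n) (h i x)%:C *: (g i x - f x).
    under [RHS]eq_bigr do rewrite scalerBr.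
    by rewrite sumrB -scaler_suml h1C scale1r.
  apply: le_trans (rnorm_sum _ _ _) _.
  have -> : 2 * a = \sum_(i < n) h i x * (2 * a) by rewrite -mulr_suml h1 mul1r.
  apply: ler_sum => i _.
  rewrite rnormZ rh; have [Vi|nV] := pselect ((t (p i)).1 x); last first.
    by rewrite (hV0 _ _ nV) !mul0r.
  by apply: ler_wpM2l => //; have [_ _ gf _ _] := tQ (p i); exact: gf.
Qed.

Lemma section_through (x0 : X) (s0 : fiber E x0) :
  exists s : sections E, s x0 = s0.
Proof.
pose C := rnorm s0 + rnorm s0 + 1.
have C0 : 0 < C by have := rnorm_ge0 s0; rewrite /C; lra.
pose a n : R := C / 2 ^+ n.
have a0 n : 0 < a n by rewrite divr_gt0// exprn_gt0.
(* The iteration starts from [s0] at [x0] and zero elsewhere; its error is at most [2 * rnorm s0],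
   which is below [C]. *)
pose f0 y : fiber E y :=
  if pselect (x0 = y) is left e then eq_rect x0 (fiber E) s0 y e else 0.
have f00 : f0 x0 = s0.
  by rewrite /f0; case: pselect => // e; rewrite (Prop_irrelevance e erefl).
have f0a x : approx_section f0 (f0 x) (a 0).
  have f0s y : rnorm (f0 y) <= rnorm s0.
    by rewrite /f0; case: pselect => [e|_]; [case: _ / e|rewrite rnorm0 rnorm_ge0].
  apply: approx_section_le (approx_section_bounded f0s (f0s x)).
  by rewrite /a expr0 divr1 /C; lra.
(* The hypothesis on [f] is moved inside the existential, so that a step exists for every [f] and
   can be iterated; without it, [f] itself is returned. *)
have stepP n f : exists f' : forall y, fiber E y,
    (forall x, approx_section f (f x) (a n)) ->
    [/\ f' x0 = f x0, forall x, approx_section f' (f' x) (a n.+1) &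
        forall x, rnorm (f' x - f x) <= 2 * a n].
  have [fa|nfa] := pselect (forall x, approx_section f (f x) (a n)); last by exists f.
  by have [f' H] := approx_section_step x0 (a0 n) (a0 n.+1) fa; exists f'.
pose step n f := sval (cid (stepP n f)).
have stepS n f : (forall x, approx_section f (f x) (a n)) ->
    [/\ step n f x0 = f x0, forall x, approx_section (step n f) (step n f x) (a n.+1) &
        forall x, rnorm (step n f x - f x) <= 2 * a n].
  exact: svalP (cid (stepP n f)).
pose F := fix F n := if n is m.+1 then step m (F m) else f0.
have Fa n x : approx_section (F n) (F n x) (a n).
  elim: n x => [|n IH] x; first exact: f0a.
  by have [_ H _] := stepS n (F n) IH; exact: H.
have FS n x : rnorm (F n.+1 x - F n x) <= 2 * C / 2 ^+ n.
  by have [_ _ H] := stepS n (F n) (Fa n); have := H x; rewrite mulrA.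
have F0 n : F n x0 = s0.
  elim: n => [|n IH]; first exact: f00.
  by have [H _ _] := stepS n (F n) (Fa n); rewrite -IH -H.
have limP x := cid (geometric_limit (fun n => FS n x)).
pose f x := sval (limP x).
have fF x n : rnorm (f x - F n x) <= 2 * (2 * C) / 2 ^+ n by exact: svalP (limP x) n.
(* Write [f] as [F n] plus the correction [f - F n]: the first has error [a n], and the second is
   uniformly of order [C / 2 ^+ n]. *)
have fa x e : 0 < e -> approx_section f (f x) e.
  move=> e0; have [n ne] := div_exp2_lt (C + 2 * (2 * (2 * C))) e0.
  have := approx_sectionD (Fa n x) (approx_section_bounded (fun y => fF y n) (fF x n)).
  rewrite [F n x + _]addrC subrK.
  rewrite (_ : (fun y => _) = f); last first.
    by apply: functional_extensionality_dep => y; rewrite addrC subrK.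
  apply: approx_section_le; apply: ltW; apply: le_lt_trans ne.
  by rewrite /a; set q := (2 ^+ n)^-1; lra.
exists (MkSection (fun x => approx_section_cvg (fa x))).
(* No step changes the value at [x0], so the distance from [f x0] to [s0] is below every positive
   bound. *)
apply/eqP; rewrite -subr_eq0 -rnorm_eq0 eq_le rnorm_ge0 andbT /=.
rewrite leNgt; apply/negP => /(div_exp2_lt (2 * (2 * C)))[n].
by have := fF x0 n; rewrite F0 => + /lt_le_trans H => /H; rewrite ltxx.
Qed.

End EnoughSections.

(** * Local frames *)

Section FiniteBases.

(** A spanning family of minimal length is free: a relation with a nonzero coefficient would allow
    one vector to be dropped. *)
Lemma finitely_generated_basis (K : fieldType) (V : lmodType K) :
  finitely_generated V -> exists (d : nat) (v : 'I_d -> V),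
    (forall u : V, exists a : 'I_d -> K, u = \sum_(i < d) a i *: v i) /\
    (forall a : 'I_d -> K, \sum_(i < d) a i *: v i = 0 -> forall i, a i = 0).
Proof.
pose spans d := exists v : 'I_d -> V, forall u : V,
  exists a : 'I_d -> K, u = \sum_(i < d) a i *: v i.
move=> fgV; have : exists n, `[< spans n >].
  by have [n [v vP]] := fgV; exists n; apply/asboolP; exists v.
move=> /ex_minnP[d /asboolP[v vP] dmin]; exists d, v; split => // a a0 j.
apply/eqP/negPn/negP => aj.
case: d v vP dmin a a0 j aj => [|d] v vP dmin a a0 j aj; first by case: j aj.
suff /asboolP/dmin : spans d by rewrite ltnn.
exists (fun k => v (lift j k)) => u; have [b ->] := vP u.
exists (fun k => b (lift j k) - b j * (a j)^-1 * a (lift j k)).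
have vj : v j = - \sum_(k < d) ((a j)^-1 * a (lift j k)) *: v (lift j k).
  apply: (scalerI aj); move/eqP: a0; rewrite (bigD1_ord j)//= addr_eq0 => /eqP ->.
  rewrite scalerN scaler_sumr; congr (- _); apply: eq_bigr => k _.
  by rewrite scalerA mulrA divff// mul1r.
rewrite (bigD1_ord j)//= vj scalerN scaler_sumr addrC -sumrB.
by apply: eq_bigr => k _; rewrite scalerBl scalerA mulrA.
Qed.

End FiniteBases.

(** * Stability of linear independence *)

Section NearIndependence.
Context {R : realType}.

(** The square with real and imaginary parts in [[-1, 1]] is a continuous image of a compact product
    and contains the unit disk. *)
Lemma compact_square : exists2 Q : set R[i], compact Q &
  forall z : R[i], rnorm z <= 1 -> Q z.
Proof.
pose f (p : R * R) : R[i] := p.1%:C + 'i%C * p.2%:C.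
exists (f @` (`[-1, 1] `*` `[-1, 1])).
  apply: continuous_compact; last by apply: compact_setX; exact: segment_compact.
  apply: continuous_subspaceT => p.
  apply: (@cvgD _ R[i]^o).
    apply: (@continuous_comp _ _ _ fst (fun a : R => a%:C)); first exact: cvg_fst.
  exact: real_complex_continuous.
  apply: (@cvgM R[i]); first exact: cvg_cst.
  apply: (@continuous_comp _ _ _ snd (fun a : R => a%:C)); first exact: cvg_snd.
  exact: real_complex_continuous.
move=> z z1; exists (complex.Re z, complex.Im z); last by rewrite /f/= -complexE.
have ReN (w : R[i]) : `|complex.Re w| <= rnorm w.
  by rewrite -lecR -rnormE normc_ge_Re.
have ImN : `|complex.Im z| <= rnorm z.
  (* The imaginary part of [z] is minus the real part of [z] times the imaginary unit. *)
  rewrite -[X in X <= _]normrN -ReiNIm; apply: le_trans (ReN _) _.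
  by rewrite rnormM [rnorm 'i%C]/rnorm normc_def/= expr0n/= expr1n add0r sqrtr1 mulr1.
by split; rewrite /= in_itv/= -ler_norml; [exact: le_trans z1|exact: le_trans z1].
Qed.

Context {X : topologicalType} (E : banach_bundle R X).
Hypothesis continuousE : continuous_bundle E.

Lemma near_independent (x : X) (d : nat) (t : 'I_d -> sections E) :
  (forall c : 'I_d -> R[i], \sum_(i < d) c i *: t i x = 0 -> forall i, c i = 0) ->
  exists2 m : R, 0 < m & \forall y \near x, forall (c : 'I_d -> R[i]) i,
    m * rnorm (c i) <= rnorm (\sum_(i < d) c i *: t i y).
Proof.
move=> free_t; have [Q cQ Q1] := compact_square.
(* The compact sets [A j], with coordinate [j] equal to 1, stand in for the unit sphere: dividing a
   nonzero vector by a coordinate of largest norm lands in one of them. *)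
pose A j := [set v : 'rV[R[i]]_d | forall i, (if i == j then [set 1] else Q) (v ord0 i)].
have cA j : compact (A j).
  apply: (@rV_compact _ _ (fun i => if i == j then [set 1] else Q)) => i.
  by case: ifP => _ //; exact: compact_set1.
pose N (v : 'rV[R[i]]_d) (y : X) := rnorm (\sum_(i < d) v ord0 i *: t i y).
(* The lower bound is a second variable tending to 0 from the right, so that one compactness
   argument yields the neighborhood of [x] and the bound together. *)
pose F := filter_prod (nbhs x) ((0 : R)^'+).
have AN j : \forall p \near F, A j `<=` (fun v => p.2 < N v p.1).
  suff H v : A j v -> \forall v' \near v & p \near F, p.2 < N v' p.1.
    exact: ((compact_near_coveringP _).1 (cA j) _ F (fun p v => p.2 < N v p.1) _ H).
  move=> Av.
  have N0 : 0 < N v x.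
    rewrite rnorm_gt0; apply/eqP => /free_t/(_ j).
    by have := Av j; rewrite eqxx => -> /eqP; rewrite oner_eq0.
  have b2 : (fun z : 'rV[R[i]]_d * (X * R) => z.2.1) @ filter_prod (nbhs v) F --> x.
    exact: (cvg_comp _ _ (@cvg_snd _ _ _ _ _) (@cvg_fst _ _ _ _ _)).
  have : (fun z : 'rV[R[i]]_d * (X * R) =>
      in_fiber (\sum_(i < d) z.1 ord0 i *: t i z.2.1)) @ filter_prod (nbhs v) F -->
      in_fiber (\sum_(i < d) v ord0 i *: t i x).
    apply: cvg_fiber_sum => // i; apply: cvg_fiber_scale.
      apply: (@cvg_comp _ _ _ (fun z : 'rV[R[i]]_d * (X * R) => z.1)
        (fun w : 'rV[R[i]]_d => w ord0 i) _ (nbhs v)); first exact: cvg_fst.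
      exact: coord_continuous.
    exact: (cvg_comp _ _ b2 (@section_continuous _ _ _ (t i) x)).
  (* Upper semicontinuity would not suffice here: the norm must stay above half of its value at
     [(v, x)]. *)
  move=> /cvg_comp/(_ (@continuousE _)) Nv.
  have {Nv} N1 : \forall z \near filter_prod (nbhs v) F, N v x / 2 < N z.1 z.2.1.
    by apply: (cvgr_gt _ Nv); rewrite ltr_pdivrMr// ltr_pMr// ltr1n.
  have N2 : \forall z \near filter_prod (nbhs v) F, z.2.2 < N v x / 2.
    have : \forall a \near (0 : R)^'+, a < N v x / 2.
      by apply: nbhs_right_lt; rewrite divr_gt0.
    have c2 : (fun z : 'rV[R[i]]_d * (X * R) => z.2.2) @ filter_prod (nbhs v) F -->
        (0 : R)^'+.
      exact: (cvg_comp _ _ (@cvg_snd _ _ _ _ _) (@cvg_snd _ _ _ _ _)).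
    exact: c2.
  by apply: filterS2 N1 N2 => z /= z1 z2; exact: lt_trans z1.
have [[/= U B] [Ux B0] UB] := filter_forall _ AN.
have [m [Bm m0]] : exists m, B m /\ 0 < m.
  apply: (@filter_ex _ ((0 : R)^'+)); apply: filterI B0 _; exact: nbhs_right_gt.
exists m => //; apply: filterS Ux => y Uy c i.
have [k _ kmax] := arg_maxP (fun k => rnorm (c k)) (isT : xpredT i).
apply: (@le_trans _ _ (m * rnorm (c k))).
  by apply: ler_wpM2l; [exact: ltW|exact: kmax].
have [ck0|ck0] := eqVneq (c k) 0; first by rewrite ck0 rnorm0 mulr0 rnorm_ge0.
have rck : 0 < rnorm (c k) by rewrite rnorm_gt0.
rewrite -ler_pdivlMr// mulrC -rnormV -rnormZ scaler_sumr.
have Av : A k (\row_l ((c k)^-1 * c l)).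
  move=> l; rewrite mxE; case: ifPn => [/eqP->|_]; first by rewrite /= mulVf.
  by apply: Q1; rewrite rnormM rnormV mulrC ler_pdivrMr// mul1r; exact: kmax.
have := UB (y, m) (conj Uy Bm) k _ Av; rewrite /N/= => /ltW.
by under eq_bigr do rewrite mxE -scalerA.
Qed.

End NearIndependence.

(** * Modules with a finite dual basis *)

Section DualBasis.

Lemma linear_comb (K : pzRingType) (V W : lmodType K) (f : V -> W) (I : Type)
    (r : seq I) (a : I -> K) (v : I -> V) : linear f ->
  f (\sum_(i <- r) a i *: v i) = \sum_(i <- r) a i *: f (v i).
Proof.
move=> lf; pose lfm := GRing.isLinear.Build _ _ _ _ f lf.
pose F : {linear V -> W} := HB.pack f lfm.
rewrite -[LHS]/(F _) linear_sum; apply: eq_bigr => i _.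
exact: (linearZ_LR F).
Qed.

Variables (A : pzRingType) (P : lmodType A) (I : finType) (g : I -> P).
Variable lam : I -> P -> A.
Hypothesis lamL : forall i (a : A) (u v : P), lam i (a *: u + v) = a * lam i u + lam i v.
Hypothesis lamg : forall u, u = \sum_(i : I) lam i u *: g i.

Lemma dual_basis_finitely_generated : finitely_generated P.
Proof.
exists #|I|, (fun k => g (enum_val k)) => u; exists (fun k => lam (enum_val k) u).
rewrite {1}(lamg u) (reindex (@enum_val I predT))//=.
by exists enum_rank => i _; [exact: enum_valK|exact: enum_rankK].
Qed.

(** Lift the images of the [g i] through [f] and recombine the lifts with the coordinates [lam i u],
    which are linear in [u]. *)
Lemma dual_basis_projective : projective P.
Proof.
move=> M N f q fsurj; have [m fm] := choice (fun i => fsurj (q (g i))).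
pose h u := \sum_(i : I) lam i u *: m i.
have lh : linear h.
  move=> a u v; rewrite /h scaler_sumr -big_split/=; apply: eq_bigr => i _.
  by rewrite lamL scalerDl scalerA.
pose hm := GRing.isLinear.Build _ _ _ _ h lh.
pose H : {linear P -> M} := HB.pack h hm.
exists H => u; rewrite {2}(lamg u) !linear_sum; apply: eq_bigr => i _.
by rewrite !linearZ_LR/= fm.
Qed.

End DualBasis.

(** * Coordinates in a local frame *)

Section LocalFrames.
Context {R : realType} {X : topologicalType} (E : banach_bundle R X).

(* The lower bound [m] is uniform in the base point: it makes the coordinates of
   a varying vector continuous. *)
Definition frame_at d (t : 'I_d -> sections E) (m : R) (y : X) : Prop :=
  (forall e : fiber E y, exists c : 'I_d -> R[i], e = \sum_(i < d) c i *: t i y) /\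
  (forall (c : 'I_d -> R[i]) i, m * rnorm (c i) <= rnorm (\sum_(i < d) c i *: t i y)).

(** The hub of the equivalence: over a compact Hausdorff space and with continuous norm, it is
    derived from each of the conditions and gives each of them back. *)
Definition has_local_frames : Prop := forall x : X,
  exists (d : nat) (t : 'I_d -> sections E) (m : R),
    0 < m /\ \forall y \near x, frame_at t m y.

Section Coordinates.
Context {d : nat} (t : 'I_d -> sections E) (m : R).
Hypothesis m0 : 0 < m.

(** A choice of coefficients, zero outside the span. At points where [t] is a frame, the lower bound
    makes the choice unique. *)
Definition frame_coord (y : X) (e : fiber E y) : 'I_d -> R[i] :=
  if pselect (exists c : 'I_d -> R[i], e = \sum_(i < d) c i *: t i y) is left h
  then sval (cid h) else fun=> 0.

Lemma frame_coordE y (e : fiber E y) : frame_at t m y ->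
  e = \sum_(i < d) frame_coord e i *: t i y.
Proof.
move=> [span _]; rewrite /frame_coord; case: pselect => [h|[]//].
exact: svalP (cid h).
Qed.

(** The lower bound of the frame, applied to a difference of coefficients. Boundedness, uniqueness
    and continuity of the coordinates all come from it. *)
Lemma frame_coord_dist y (e : fiber E y) (c : 'I_d -> R[i]) i : frame_at t m y ->
  m * rnorm (c i - frame_coord e i) <= rnorm (\sum_(i < d) c i *: t i y - e).
Proof.
move=> fy; rewrite {2}(frame_coordE e fy) -sumrB.
under [X in _ <= rnorm X]eq_bigr do rewrite -scalerBl.
by have [_ +] := fy => /(_ (fun i => c i - frame_coord e i)); exact.
Qed.

Lemma frame_coord_le y (e : fiber E y) i : frame_at t m y ->
  rnorm (frame_coord e i) <= rnorm e / m.
Proof.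
move=> /(frame_coord_dist e (fun=> 0) i); rewrite sub0r rnormN big1 ?sub0r ?rnormN.
  by rewrite ler_pdivlMr// mulrC.
by move=> j _; rewrite scale0r.
Qed.

Lemma frame_coord_unique y (e : fiber E y) (c : 'I_d -> R[i]) i : frame_at t m y ->
  e = \sum_(i < d) c i *: t i y -> frame_coord e i = c i.
Proof.
move=> fy ec; apply/eqP; rewrite eq_sym -subr_eq0 -rnorm_eq0 eq_le rnorm_ge0 andbT.
by have := frame_coord_dist e c i fy; rewrite -ec subrr rnorm0 pmulr_rle0.
Qed.

Lemma frame_coord_linear y (a : R[i]) (e f : fiber E y) i : frame_at t m y ->
  frame_coord (a *: e + f) i = a * frame_coord e i + frame_coord f i.
Proof.
move=> fy.
apply: (frame_coord_unique
  (c := fun i => a * frame_coord e i + frame_coord f i)) => //.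
rewrite {1}(frame_coordE e fy) {1}(frame_coordE f fy) scaler_sumr -big_split/=.
by apply: eq_bigr => j _; rewrite scalerDl scalerA.
Qed.

(** Freeze the coefficients of [u]: their combination of the [t i (b z)] also tends to [u], so its
    difference from [f z] tends to zero, and [frame_coord_dist] passes this on to the
    coordinates. *)
Lemma frame_coord_cvg {Z : Type} (F : set_system Z) {FF : Filter F} (b : Z -> X)
    (f : forall z, fiber E (b z)) (y : X) (u : fiber E y) i :
  (fun z => in_fiber (f z)) @ F --> in_fiber u ->
  (\forall z \near F, frame_at t m (b z)) -> frame_at t m y ->
  (fun z => frame_coord (f z) i) @ F --> frame_coord u i.
Proof.
move=> fu fb fy; apply/(@cvg_rnormP _ R[i]^o) => e e0.
have byy := cvg_base fu.
have sub : (fun z => in_fiber (\sum_(i < d) frame_coord u i *: t i (b z) - f z)) @ F -->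
    in_fiber (0 : fiber E y).
  rewrite -(subrr u) {2}(frame_coordE u fy).
  apply: cvg_fiber_sub => //; apply: cvg_fiber_sum => // j.
  apply: cvg_fiber_scale; first exact: cvg_cst.
  exact: (cvg_comp _ _ byy (@section_continuous _ _ _ (t j) y)).
have : \forall z \near F, rnorm (\sum_(i < d) frame_coord u i *: t i (b z) - f z) < m * e.
  by apply: near_rnorm_lt sub _; rewrite rnorm0 mulr_gt0.
apply: filterS2 fb => z fz ze.
by have := le_lt_trans (frame_coord_dist (f z) (frame_coord u) i fz) ze; rewrite ltr_pM2l.
Qed.

End Coordinates.

End LocalFrames.

(** * Local frames from finite generation *)

Section SectionsFinitelyGenerated.
Context {R : realType} {X : topologicalType}.
Local Notation CX := (continuousType X R[i]).

(** Named in order to carry a ring morphism structure, through which determinants commute with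
    evaluation. *)
Definition cts_eval (x : X) (f : CX) : R[i] := f x.

Lemma cts_eval_is_additive x : zmod_morphism (cts_eval x).
Proof. by []. Qed.

Lemma cts_eval_is_multiplicative x : monoid_morphism (cts_eval x).
Proof. by []. Qed.

HB.instance Definition _ x :=
  GRing.isZmodMorphism.Build CX R[i] (cts_eval x) (cts_eval_is_additive x).
HB.instance Definition _ x :=
  GRing.isMonoidMorphism.Build CX R[i] (cts_eval x) (cts_eval_is_multiplicative x).

Context (E : banach_bundle R X).

Lemma section_scaleE (f : CX) (s : sections E) y : (f *: s) y = f y *: s y.
Proof. by []. Qed.

Lemma section_subE (s t : sections E) y : (s - t) y = s y - t y.
Proof. by []. Qed.

Lemma section_sumE (I : Type) (r : seq I) (s : I -> sections E) y :
  (\sum_(i <- r) s i) y = \sum_(i <- r) s i y.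
Proof. by elim/big_rec2 : _ => // i u v _ <-. Qed.

Definition cts_cst (a : R[i]) : CX := mkcts (fun x => @cvg_cst _ a _ (nbhs x) _).

(** The quotient of [r] by the square root [n] of its norm again has norm [n], which tends to zero
    at the zeros of [r]; hence the quotient is continuous there too. *)
Lemma vanishing_section (r : sections E) (x : X) : continuous_bundle E -> r x = 0 ->
  exists (h : CX) (s : sections E), h x = 0 /\ r = h *: s.
Proof.
move=> continuousE rx.
pose n y := Num.sqrt (rnorm (r y)).
have n0 y : (n y == 0) = (r y == 0).
  by rewrite sqrtr_eq0 le_eqVlt ltNge rnorm_ge0 orbF rnorm_eq0.
have nn y : n y * n y = rnorm (r y) by rewrite -expr2 sqr_sqrtr// rnorm_ge0.
have cn : continuous n.
  move=> y.
  apply: (@cvg_comp _ _ _ (fun z => rnorm (r z)) (@Num.sqrt R) _ (nbhs (rnorm (r y)))).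
    exact: (cvg_comp _ _ (@section_continuous _ _ _ r y) (@continuousE _)).
  exact: sqrt_continuous.
have ch : continuous (fun y => (n y)%:C : R[i]).
  move=> y; apply: (@cvg_comp _ _ _ n (fun a : R => a%:C) _ (nbhs (n y))).
    exact: cn.
  exact: real_complex_continuous.
(* The inverse of zero is zero, so the formula also holds at the zeros of [r]. *)
have sn y : rnorm (((n y)%:C)^-1 *: r y) = n y.
  rewrite rnormZ rnormV rnorm_real ger0_norm ?sqrtr_ge0// -nn.
  by have [->|ny] := eqVneq (n y) 0; rewrite ?mulr0// mulKf.
have cs : continuous (fun y => in_fiber (((n y)%:C)^-1 *: r y)).
  move=> y; have [ny|ny] := eqVneq (n y) 0; last first.
    apply: cvg_fiber_scale; last exact: section_continuous.
    apply: (@cvgV R[i]); last exact: ch.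
    by rewrite (inj_eq (@complexI R) (n y) 0).
  have ry : r y = 0 by apply/eqP; rewrite -n0 ny.
  rewrite /continuous_at/= ry scaler0; apply: cvg_fiber0; first exact: cvg_id.
  move=> e e0; near=> z; rewrite sn; near: z.
  by apply: (cvgr_lt _ (cn y)); rewrite ny.
exists (mkcts ch), (MkSection cs); split.
  by rewrite -[LHS]/((n x)%:C) /n rx rnorm0 sqrtr0.
apply: sectionP => y; rewrite -[RHS]/((n y)%:C *: (((n y)%:C)^-1 *: r y)) scalerA.
have [ny|ny] := eqVneq (n y) 0.
  have /eqP -> : r y == 0 by rewrite -n0 ny.
  by rewrite scaler0.
by rewrite divff ?scale1r// (inj_eq (@complexI R) (n y) 0).
Unshelve. all: by end_near. Qed.

Lemma finitely_generated_local_frames :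
  compact [set: X] -> hausdorff_space X -> continuous_bundle E ->
  finitely_generated (sections E) -> has_local_frames E.
Proof.
move=> compactX hausdorffX continuousE [n [s sspan]] x.
have fgx : finitely_generated (fiber E x).
  exists n, (fun i => s i x) => e.
  have [u ux] := section_through compactX hausdorffX e.
  have [a ua] := sspan u; exists (fun i => a i x).
  by rewrite -ux ua section_sumE.
have [d [v [vspan vfree]]] := finitely_generated_basis fgx.
have [t tv] := choice (fun i => section_through compactX hausdorffX (v i)).
have free_t (c : 'I_d -> R[i]) : \sum_(i < d) c i *: t i x = 0 -> forall i, c i = 0.
  by under eq_bigr do rewrite tv; exact: vfree.
have [m m0 mt] := near_independent continuousE free_t.
exists d, t, m; split => //.
have [alpha salpha] := choice (fun j => vspan (s j x)).
(* [w j] is the combination of the [t i] with constant coefficients that agrees with [s j] at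
   [x]. *)
pose w j := \sum_(i < d) cts_cst (alpha j i) *: t i.
have wE j y : w j y = \sum_(i < d) alpha j i *: t i y by rewrite /w section_sumE.
have rP j : exists hu : CX * sections E, hu.1 x = 0 /\ s j - w j = hu.1 *: hu.2.
  have [|h [u [hx ru]]] := vanishing_section (r := s j - w j) (x := x) continuousE.
    rewrite section_subE wE salpha -sumrB big1// => i _.
    by rewrite tv subrr.
  by exists (h, u).
have [hu huP] := choice rP.
have [b bP] := choice (fun j => sspan (hu j).2).
(* This is [1 - C]: the remainder [s j - w j] is a combination of the [s k] with coefficients
   [(hu j).1 * b j k], all zero at [x]. *)
pose M : 'M[CX]_n := 1%:M - \matrix_(j, k) ((hu j).1 * b j k).
have Ms j : \sum_(k < n) M j k *: s k = w j.
  under eq_bigr do rewrite !mxE scalerBl.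
  rewrite sumrB (bigD1 j)//= eqxx scale1r big1 ?addr0; last first.
    by move=> k /negPf; rewrite eq_sym => ->; rewrite scale0r.
  under eq_bigr do rewrite -scalerA.
  rewrite -scaler_sumr -bP; have [_ <-] := huP j.
  by rewrite subKr.
(* Cramer's rule avoids inverting [M] over the ring of functions; only the value of the determinant
   near [x] is inverted later. *)
have adjs k : \sum_(j < n) \adj M k j *: w j = \det M *: s k.
  under eq_bigr do rewrite -Ms scaler_sumr.
  rewrite exchange_big/=.
  transitivity (\sum_(l < n) (\adj M *m M) k l *: s l).
    apply: eq_bigr => l _; rewrite mxE scaler_suml.
    by apply: eq_bigr => j _; rewrite scalerA.
  rewrite mul_adj_mx (bigD1 k)//= mxE eqxx mulr1n big1 ?addr0// => l.
  by rewrite mxE eq_sym => /negPf ->; rewrite mulr0n scale0r.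
have detx : (\det M : CX) x = 1.
  rewrite -/(cts_eval x (\det M)) -det_map_mx.
  rewrite (_ : map_mx _ M = 1%:M) ?det1//; apply/matrixP => j k.
  rewrite !mxE rmorphB rmorphM rmorph_nat/=.
  by have [hx _] := huP j; rewrite [cts_eval x (hu j).1]hx mul0r subr0.
have detn : \forall y \near x, (\det M : CX) y != 0.
  have := @cts_fun _ _ (\det M : CX) x => /(@cvg_rnormP _ R[i]^o)/(_ 1 ltr01).
  apply: filterS => y; rewrite detx; apply: contraTneq => ->.
  by rewrite subr0 (_ : 1 = 1%:C)// rnorm_real normr1 ltxx.
apply: filterS2 detn mt => y dety mty; split => // e.
have [u ue] := section_through compactX hausdorffX e.
have [a ua] := sspan u.
(* Expand [e] in the [s k], each [s k] in the [w j] by Cramer's rule, and each [w j] in the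
   [t i]. *)
exists (fun i => \sum_(k < n) \sum_(j < n)
  (a k y * ((\det M : CX) y)^-1 * (\adj M k j : CX) y * alpha j i)).
have sk k : s k y = ((\det M : CX) y)^-1 *:
    \sum_(j < n) (\adj M k j : CX) y *: \sum_(i < d) alpha j i *: t i y.
  apply: (scalerI dety); rewrite scalerA divff// scale1r.
  rewrite -section_scaleE -adjs section_sumE.
  by apply: eq_bigr => j _; rewrite section_scaleE wE.
rewrite -ue ua section_sumE.
under eq_bigr => k _.
  rewrite section_scaleE sk scalerA scaler_sumr.
  under eq_bigr do rewrite scalerA scaler_sumr.
  over.
under [RHS]eq_bigr do rewrite scaler_suml.
rewrite [RHS]exchange_big/=; apply: eq_bigr => k _.
under [RHS]eq_bigr do rewrite scaler_suml.
rewrite [RHS]exchange_big/=; apply: eq_bigr => j _.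
by apply: eq_bigr => i _; rewrite scalerA.
Qed.

End SectionsFinitelyGenerated.

(** * Equivalence of the conditions *)

Lemma open_cylinder (X Y : topologicalType) (U : set X) :
  open U -> open (U `*` [set: Y]).
Proof.
move=> oU; rewrite (_ : _ `*` _ = fst @^-1` U); last first.
  by apply/seteqP; split => p /=; [case|].
by apply: open_comp => // p _; exact: cvg_fst.
Qed.

Section Equivalence.
Context {R : realType} {X : topologicalType} (E : banach_bundle R X).
Local Notation CX := (continuousType X R[i]).

Lemma local_frames_finite_rank : has_local_frames E -> finite_rank E.
Proof.
move=> frames x; have [d [t [m [_ /nbhs_singleton[span _]]]]] := frames x.
by exists d, (fun i => t i x).
Qed.

Lemma local_frames_locally_trivial : has_local_frames E -> locally_trivial E.
Proof.
move=> frames x; have [d [t [m [m0 mt]]]] := frames x.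
pose U := interior [set y | frame_at t m y].
have oU : open U by exact: open_interior.
have Uf y : U y -> frame_at t m y by exact: interior_subset.
have fx : frame_at t m x by exact: nbhs_singleton mt.
exists U; split; [exact: oU|exact: mt|].
(* The model space is the fiber at [x]; [phi] and [psi] keep the coordinates and exchange the frame
   at [y] with the frame at [x]. *)
pose phi y (e : fiber E y) : fiber E x := \sum_(i < d) frame_coord t e i *: t i x.
pose psi y (e : fiber E x) : fiber E y := \sum_(i < d) frame_coord t e i *: t i y.
exists (fiber E x), phi, psi; split.
- move=> y Uy a u v; rewrite /phi scaler_sumr -big_split/=; apply: eq_bigr => i _.
  by rewrite (frame_coord_linear m0 _ _ _ _ (Uf _ Uy)) scalerDl scalerA.
- move=> y Uy; split=> e.
  + rewrite [RHS](frame_coordE e (Uf _ Uy)); apply: eq_bigr => i _; congr (_ *: _).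
    exact: (@frame_coord_unique _ _ E d t m m0 x _ (frame_coord t e) i fx erefl).
  + rewrite [RHS](frame_coordE e fx); apply: eq_bigr => i _; congr (_ *: _).
    exact: (@frame_coord_unique _ _ E d t m m0 y _ (frame_coord t e) i (Uf _ Uy) erefl).
- rewrite continuous_open_subspace; last first.
    by apply: open_comp => // w _; exact: (bundle_proj_continuous (banach_bundleP E)).
  move=> [y u]; rewrite inE /= => Uy.
  have nU : \forall w \near in_fiber u, frame_at t m (base w).
    by apply: near_proj_total; apply: filterS Uf _; exact: open_nbhs_nbhs.
  have H1 : @bundle_proj _ _ E @ in_fiber u --> y.
    exact: (bundle_proj_continuous (banach_bundleP E) (x := in_fiber u)).
  pose F : set_system (bundle_total E) := nbhs (in_fiber u).
  have FF : Filter F by exact: nbhs_filter.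
  have H2 : (fun s : bundle_total E => phi (bundle_proj s) (vec s)) @ F --> phi y u.
    apply: cvg_big => [|i _]; first exact: add_continuous.
    apply: cvgZ; last exact: cvg_cst.
    exact: (@frame_coord_cvg _ _ E d t m m0 _ F FF (@bundle_proj _ _ E)
      (fun w => vec w) y u i (@cvg_total _ _ E y u) nU (Uf _ Uy)).
  exact: (cvg_pair H1 H2).
- rewrite continuous_open_subspace; last exact: open_cylinder.
  move=> [y e]; rewrite inE /= => -[Uy _].
  apply: (@cvg_fiber_sum _ _ E _ _ _ fst) => [|i]; first exact: cvg_fst.
  apply: cvg_fiber_scale.
    apply: (@cvg_comp _ _ _ snd (fun e : fiber E x => frame_coord t e i) _ (nbhs e)).
      exact: cvg_snd.
    (* On the fixed fiber at [x], the frame bound makes the coordinates Lipschitz with constant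
       [1 / m]. *)
    apply/(@cvg_rnormP _ R[i]^o) => r r0.
    have : \forall e' \near e, rnorm (e - e') < m * r.
      exact: (@cvg_rnormP _ _ _ (nbhs e) _ id e).1 (@cvg_id _ _) _ (mulr_gt0 m0 r0).
    apply: filterS => e' ee'; rewrite -(ltr_pM2l m0).
    apply: le_lt_trans (frame_coord_dist e' (frame_coord t e) i fx) _.
    by rewrite -(frame_coordE e fx).
  apply: (@cvg_comp _ _ _ fst (fun y => in_fiber (t i y)) _ (nbhs y)).
    exact: cvg_fst.
  exact: (@section_continuous _ _ _ (t i) y).
Qed.

Hypotheses (compactX : compact [set: X]) (hausdorffX : hausdorff_space X).
Hypothesis continuousE : continuous_bundle E.

Lemma locally_trivial_local_frames :
  locally_trivial E -> finite_rank E -> has_local_frames E.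
Proof.
move=> ltE frE x; have [U [oU Ux [E0 [phi [psi [lphi phiK _ psi_cts]]]]]] := ltE x.
have [d [v [vspan vfree]]] := finitely_generated_basis (frE x).
have [h [ch h0 hx hU]] := bump_function (R := R) compactX hausdorffX
  (open_nbhs_nbhs (conj oU Ux)).
(* Unlike [h], the cutoff [k] has its support inside [U]. *)
pose k y := Num.max (h y - 2^-1) 0.
have ck : continuous k.
  move=> y; apply: (@continuous_max _ _ (fun y => h y - 2^-1) (fun=> 0)).
    by apply: cvgB; [exact: ch|exact: cvg_cst].
  exact: cvg_cst.
have k0 y : h y <= 2^-1 -> k y = 0.
  by move=> hy; rewrite /k; apply/max_idPr; rewrite subr_le0.
have kx : k x = 2^-1.
  by rewrite /k hx; apply: etrans (_ : 1 - 2^-1 = _); [apply/max_idPl|]; lra.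
have psi_lin y a (w : 'I_d -> E0) : U y ->
    psi y (\sum_(i < d) a i *: w i) = \sum_(i < d) a i *: psi y (w i).
  move=> Uy; have [phK psK] := phiK y Uy; apply: (can_inj phK).
  rewrite psK linear_comb; last exact: lphi.
  by apply: eq_bigr => i _; rewrite psK.
(* The trivialization carries the basis vector [v i] from the fiber at [x] to the one at [y]; the
   cutoff [k] extends the result by zero to a global section. *)
pose e i y : fiber E y := (k y)%:C *: psi y (phi x (v i)).
have ce i : continuous (fun y => in_fiber (e i y)).
  move=> y; have [Uy|nUy] := pselect (U y).
    apply: cvg_fiber_scale.
      apply: (@cvg_comp _ _ _ k (fun a : R => a%:C) _ (nbhs (k y))).
        exact: ck.
      exact: real_complex_continuous.
    move: psi_cts; rewrite continuous_open_subspace; last exact: open_cylinder.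
    move=> /(_ (y, phi x (v i))); rewrite inE => /(_ (conj Uy I)) H.
    apply: (@cvg_comp _ _ _ (fun z => (z, phi x (v i)))
      (fun p : X * E0 => in_fiber (psi p.1 p.2)) _ (nbhs (y, phi x (v i)))).
      by apply: cvg_pair; [exact: cvg_id|exact: cvg_cst].
    exact: H.
  have hy : h y = 0 by apply/eqP/negPn/negP => /hU.
  rewrite /continuous_at/= /e k0 ?hy// scale0r; apply: cvg_fiber0; first exact: cvg_id.
  move=> r r0.
  have : \forall z \near y, h z < 2^-1 by apply: (cvgr_lt _ (ch y)); rewrite hy.
  by apply: filterS => z /ltW/k0 ->; rewrite scale0r rnorm0.
pose t i := MkSection (ce i).
(* The cutoff is one half at [x], so the values there are nonzero multiples of a basis and remain
   free. *)
have tx i : t i x = (2^-1 : R)%:C *: v i.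
  by rewrite /= /e kx; have [-> _] := phiK x Ux.
have free_t (c : 'I_d -> R[i]) : \sum_(i < d) c i *: t i x = 0 -> forall i, c i = 0.
  under eq_bigr do rewrite tx scalerA.
  move=> /vfree c0 i; have /eqP := c0 i; rewrite mulf_eq0 => /orP[/eqP//|].
  by rewrite (inj_eq (@complexI R) _ 0) invr_eq0 pnatr_eq0.
have [m m0 mt] := near_independent continuousE free_t.
exists d, t, m; split => //.
have near_k : \forall y \near x, k y != 0.
  have : \forall y \near x, 0 < k y by apply: (cvgr_gt _ (ck x)); rewrite kx.
  by apply: filterS => y; exact: lt0r_neq0.
apply: filterS3 (open_nbhs_nbhs (conj oU Ux)) near_k mt => y Uy ky mty; split => // u.
(* Spanning is checked in the fiber at [x], where the trivialization carries [u]; dividing by [k y]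
   then undoes the cutoff. *)
have [c cE] := vspan (psi x (phi y u)).
have kC : (k y)%:C != 0 by rewrite (inj_eq (@complexI R) _ 0).
exists (fun i => c i / (k y)%:C).
have [phK psK] := phiK y Uy.
rewrite -{1}(phK u); have [_ psKx] := phiK x Ux.
rewrite -{1}(psKx (phi y u)) cE linear_comb; last exact: lphi.
rewrite psi_lin//; apply: eq_bigr => i _.
by rewrite /= /e scalerA divfK.
Qed.

Lemma local_frames_dual_basis : has_local_frames E ->
  exists (I : finType) (g : I -> sections E) (lam : I -> sections E -> CX),
    (forall i (a : CX) (u v : sections E),
      lam i (a *: u + v) = a * lam i u + lam i v) /\
    (forall u, u = \sum_(i : I) lam i u *: g i).
Proof.
move=> frames.
have framesT (x : X) : exists T : {d : nat & (('I_d -> sections E) * R)%type},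
    0 < (tagged T).2 /\ \forall y \near x, frame_at (tagged T).1 (tagged T).2 y.
  have [d [t [m H]]] := frames x.
  by exists (existT (fun d => ('I_d -> sections E) * R)%type d (t, m)).
have [F FP] := choice framesT.
pose V (x : X) := interior [set y | frame_at (tagged (F x)).1 (tagged (F x)).2 y].
have Vf x y : V x y -> frame_at (tagged (F x)).1 (tagged (F x)).2 y.
  exact: interior_subset.
have [|n [p [h [ch h0 hV h1]]]] :=
    partition_of_unity (R := R) compactX hausdorffX (V := V).
  by move=> x; apply: open_nbhs_nbhs; split; [exact: open_interior|have [] := FP x].
pose t l := (tagged (F (p l))).1; pose m l := (tagged (F (p l))).2.
have m0 l : 0 < m l by have [] := FP (p l).
(* The weights sit in the coordinates, so that the frame sections themselves serve as generators and
   the weighted local expansions of [u] add up to [u]. *)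
pose lam l i (s : sections E) y := (h l y)%:C * frame_coord (t l) (s y) i.
have hV0 l y : ~ V (p l) y -> h l y = 0 by move=> nV; apply/eqP/negPn/negP => /hV.
have clam l i s : continuous (lam l i s : X -> R[i]).
  move=> y; have [Vy|nVy] := pselect (V (p l) y).
    apply: (@cvgM R[i]).
      apply: (@cvg_comp _ _ _ (h l) (fun a : R => a%:C) _ (nbhs (h l y))).
        exact: ch.
      exact: real_complex_continuous.
    apply: (@frame_coord_cvg _ _ E _ (t l) (m l) (m0 l) _ (nbhs y) _ id
      (fun z => s z) y (s y) i).
    - exact: (@section_continuous _ _ _ s y).
    - apply: filterS (Vf (p l)) _; apply: open_nbhs_nbhs; split => //.
      exact: open_interior.
    - exact: (Vf (p l)).
  (* At a point outside the frame set the coordinates need not be continuous. Where the weight is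
     nonzero they are bounded by [rnorm (s z) / m l], and the weight tends to zero. *)
  rewrite /continuous_at {2}/lam (hV0 _ _ nVy) mul0r.
  apply/(@cvg_rnormP _ R[i]^o) => e e0.
  have H : (fun z => h l z * (rnorm (s z) / m l)) @ y --> 0.
    rewrite -(mul0r (rnorm (s y) / m l)) -(hV0 _ _ nVy); apply: cvgM; first exact: ch.
    apply: cvgM; last exact: cvg_cst.
    exact: (cvg_comp _ _ (@section_continuous _ _ _ s y) (@continuousE _)).
  have /(cvgr_lt _ H) : 0 < e by [].
  apply: filterS => z; apply: le_lt_trans; rewrite sub0r rnormN rnormM.
  rewrite rnorm_real ger0_norm//; have [Vz|nVz] := pselect (V (p l) z); last first.
    by rewrite (hV0 _ _ nVz) !mul0r.
  by apply: ler_wpM2l => //; apply: (frame_coord_le (m0 l)); exact: (Vf (p l)).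
(* The index is a dependent pair because the length of the frame may vary with [l]. *)
pose I := {l : 'I_n & 'I_(tag (F (p l)))}.
exists I, (fun i => t (tag i) (tagged i)), (fun i s => mkcts (clam (tag i) (tagged i) s)).
split=> [[l i] a u v|u].
  apply/continuousEP => y.
  rewrite -[LHS]/(lam l i (a *: u + v) y) -[RHS]/(a y * lam l i u y + lam l i v y) /lam.
  have [Vy|nVy] := pselect (V (p l) y); last first.
    by rewrite (hV0 _ _ nVy) !mul0r mulr0 addr0.
  by rewrite (frame_coord_linear (m0 l) _ _ _ _ (Vf (p l) _ Vy)) mulrDr mulrCA.
apply: sectionP => y; rewrite section_sumE.
rewrite -(sig_big_dep (fun l : 'I_n => true) (fun l _ => true)
  (fun l i => mkcts (clam l i u) y *: t l i y))/=.
transitivity (\sum_(l < n) (h l y)%:C *: u y).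
  by rewrite -scaler_suml -rmorph_sum/= h1 scale1r.
apply: eq_bigr => l _; have [Vy|nVy] := pselect (V (p l) y).
  rewrite {1}(frame_coordE (u y) (Vf _ _ Vy)) scaler_sumr.
  by apply: eq_bigr => i _; rewrite scalerA.
rewrite (hV0 _ _ nVy) scale0r big1// => i _.
by rewrite -[mkcts _ _]/(lam l i u y) /lam (hV0 _ _ nVy) mul0r scale0r.
Qed.

End Equivalence.

Theorem theoremA (R : realType) (X : topologicalType) (E : banach_bundle R X)
    (compactX : compact [set: X]) (hausdorffX : hausdorff_space X)
    (continuousE : continuous_bundle E) :
  ((locally_trivial E /\ finite_rank E) <->
   (finitely_generated (sections E) /\ projective (sections E))) /\
  ((finitely_generated (sections E) /\ projective (sections E)) <->
   finitely_generated (sections E)).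
Proof.
have fg_frames := finitely_generated_local_frames compactX hausdorffX continuousE.
have frames_fgp : has_local_frames E ->
    finitely_generated (sections E) /\ projective (sections E).
  move=> /(local_frames_dual_basis compactX hausdorffX continuousE).
  move=> [I [g [lam [lamL lamg]]]].
  split; first exact: dual_basis_finitely_generated lamg.
  exact: dual_basis_projective lamL lamg.
split; split.
- move=> [ltE frE]; apply: frames_fgp.
  exact: locally_trivial_local_frames.
- move=> [/fg_frames frames _]; split; first exact: local_frames_locally_trivial.
  exact: local_frames_finite_rank.
- by case.
- by move=> /fg_frames/frames_fgp.
Qed.
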